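(* Consider the join-the-shortest-queue (JSQ) system with $n$ servers, service rate $\mu>0$ per server and arrival rate $\lambda_n=n\mu(1-\epsilon_n)$, with steady-state queue length vector $\mathbf q=(q_1,\dots,q_n)\sim\pi_n$. Let $\kappa_\perp=128$ and $\theta_\perp=1/96$. Then for $0<\epsilon_n\le 1/2$ and every $\theta\in(0,\theta_\perp)$, $$\mathbb E_{\pi_n}\Big[\sum_{i=1}^n e^{-\theta q_{\perp i}}+\sum_{i=1}^n e^{\theta q_{\perp i}}\Big]\le \kappa_\perp n,$$ and for all $i\in\{1,\dots,n\}$, $$\mathbb E_{\pi_n}\big[e^{\theta|q_{\perp i}|}\big]\le\kappa_\perp,$$ where $q_{\perp i}=q_i-\frac1n\sum_{j=1}^n q_j$.
   Context: JSQ system: a continuous-time system of $n$ single-server first-come-first-served queues in parallel. Jobs arrive according to a Poisson process of rate $\lambda_n$; service times are exponential with rate $\mu$ at each server; all these are independent. $q_i(t)$ is the number of jobs at queue $i$ (including the one in service). Each arriving job is sent to a queue in $\arg\min_i q_i(t)$, ties being broken uniformly at random. Thus $\mathbf q(t)=(q_1(t),\dots,q_n(t))$ is a continuous-time Markov chain; it is positive recurrent when $\lambda_n<n\mu$. Its stationary distribution is $\pi_n$, and $\mathbf q$ denotes a random vector with law $\pi_n$. *)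

(* Defs.v *)
From HB Require Import structures.
From mathcomp Require Import all_boot all_order all_algebra.
From mathcomp Require Import all_classical all_reals all_analysis.

Set Implicit Arguments.
Unset Strict Implicit.
Unset Printing Implicit Defensive.
Import Order.TTheory GRing.Theory Num.Theory.
Import numFieldNormedType.Exports.

Local Open Scope classical_set_scope.
Local Open Scope ring_scope.

(* Queue-length vectors, with the discrete sigma-algebra (the state space is
   countable). *)
Definition queues (n : nat) := {ffun 'I_n -> nat}.

HB.instance Definition _ n := Countable.on (queues n).
HB.instance Definition _ n := isPointed.Build (queues n) [ffun=> 0%N].
HB.instance Definition _ n := @isMeasurable.Build default_measure_display
  (queues n) discrete_measurable discrete_measurable0
  discrete_measurableC discrete_measurableU.

(* Time is t >= 0; the values [P t] for t < 0 play no role. *)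
Definition markov_semigroup (d : measure_display) (S : measurableType d)
    (R : realType) (P : R -> R.-pker S ~> S) : Prop :=
  (forall (x : S) (A : set S), measurable A -> P 0 x A = \d_x A) /\
  (forall (s t : R) (x : S) (A : set S), 0 <= s -> 0 <= t -> measurable A ->
     P (s + t) x A = (\int[P s x]_y P t y A)%E).

(* The transition rates are the right derivatives at 0 of the transition
   probabilities. *)
Definition has_rates (n : nat) (R : realType)
    (P : R -> R.-pker (queues n) ~> (queues n))
    (Q : queues n -> queues n -> R) : Prop :=
  forall x y : queues n,
    (fine (P t x [set y]) - (x == y)%:R) / t @[t --> 0^'+] --> Q x y.

Definition stationary (d : measure_display) (S : measurableType d)
    (R : realType) (P : R -> R.-pker S ~> S) (pi : probability S R) : Prop :=
  forall (t : R) (A : set S), 0 <= t -> measurable A ->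
    (\int[pi]_x P t x A)%E = pi A.

Section jsq_rates.
Variables (R : realType) (n : nat) (lambda mu : R).
Implicit Types (q : queues n) (i : 'I_n).

Definition shortest q : {set 'I_n} := [set i | [forall j, (q i <= q j)%N]].

Definition arrive q i : queues n := [ffun j => (q j + (j == i))%N].
Definition depart q i : queues n := [ffun j => (q j - (j == i))%N].

(* An arriving job chooses uniformly among the shortest queues, so the Poisson
   stream of rate lambda is split evenly between them. *)
Definition arrival_rate q i : R :=
  if i \in shortest q then lambda / #|shortest q|%:R else 0.

Definition departure_rate q i : R := if (0 < q i)%N then mu else 0.

Definition jump_rate q q' : R :=
  \sum_(i < n | q' == arrive q i) arrival_rate q i +
  \sum_(i < n | q' == depart q i) departure_rate q i.

Definition exit_rate q : R :=
  \sum_(i < n) arrival_rate q i + \sum_(i < n) departure_rate q i.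

(* [jump_rate q q = 0]: when q_i = 0, [depart q i = q] but [departure_rate q i]
   vanishes. *)
Definition jsq_generator q q' : R :=
  jump_rate q q' - (if q == q' then exit_rate q else 0).

End jsq_rates.

Definition jsq_stationary (R : realType) (n : nat) (lambda mu : R)
    (pi : probability (queues n) R) : Prop :=
  exists P : R -> R.-pker (queues n) ~> (queues n),
    [/\ markov_semigroup P, has_rates P (jsq_generator lambda mu) &
        stationary P pi].

Definition q_perp (R : realType) (n : nat) (q : queues n) (i : 'I_n) : R :=
  (q i)%:R - n%:R^-1 * \sum_(j < n) (q j)%:R.

(* Main.v *)
Require Import Defs.
From mathcomp Require Import all_boot all_order all_fingroup all_algebra.
From mathcomp Require Import all_classical all_reals all_analysis.
From mathcomp Require Import finmap ring lra.
Import Order.TTheory GRing.Theory Num.Theory.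
Import numFieldNormedType.Exports.
Set Implicit Arguments.
Unset Strict Implicit.
Unset Printing Implicit Defensive.
Local Open Scope classical_set_scope.
Local Open Scope ring_scope.

(* Since the rates are bounded, 1 - P_t(x,x) <= c t, and dominated convergence
   in the stationarity equation gives global balance for the masses of pi.
   Balance extends to bounded test functions, so a drift condition
   Q Phi <= b - a Phi, applied to min(Phi, M) with M -> oo, yields
   E[Phi] <= b/a without assuming E[Phi] finite.

   Let s_i = theta q_perp_i, let m <= 0 be the least s_i, and put
   U = sum_i e^(s_i), V = sum_i e^(-s_i), Phi = U + V.  To first order in theta,
   the drift of Phi is - mu theta (1 - eps + idle/n) D, where
   D = (U - n e^m) + (n e^(-m) - V) >= 0; the remainder is O(mu theta^2) Phi.
   Both brackets may be small compared with V when few queues are very long,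
   but then U is large: because sum_i s_i = 0, a pointwise convexity inequality
   gives D >= Phi/2 - 3n.

   The bound for a single queue follows by exchangeability: the balanced
   probability is unique, as the empty state is accessible from every state, and
   the balance equations are invariant under permutations of the queues. *)

(** * Sums of non-negative terms over arbitrary index types *)

Lemma esumZl (R : realType) (T : choiceType) (I : set T) (a : T -> \bar R)
    (c : R) : (forall x, (0 <= a x)%E) -> 0 <= c ->
  (\esum_(i in I) (c%:E * a i) = c%:E * \esum_(i in I) a i)%E.
Proof.
move=> a0 c0; rewrite /esum -ereal_supZl//; last first.
  by apply/set0P; exists 0%E, set0; [exact: fsets_set0 | rewrite fsbig_set0].
congr ereal_sup; apply/seteqP; split=> [_ [X IX <-]|_ [_ [X IX <-] <-]] /=.
  exists (\sum_(x \in X) a x)%E; first by exists X.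
  by rewrite ge0_mule_fsumr.
by exists X => //; rewrite ge0_mule_fsumr.
Qed.

Lemma exchange_esum (R : realType) (T U : choiceType) (a : T -> U -> \bar R) :
  (forall x y, 0 <= a x y)%E ->
  (\esum_(x in [set: T]) \esum_(y in [set: U]) a x y =
   \esum_(y in [set: U]) \esum_(x in [set: T]) a x y)%E.
Proof.
move=> a0; rewrite !esum_esum//.
rewrite (reindex_esum ([set: U] `*`` (fun=> [set: T])) _ (fun z => (z.2, z.1)))//.
split=> //=.
- by move=> [i1 i2] [j1 j2] /= _ _ [] -> ->.
- by move=> [i1 i2] _ /=; exists (i2, i1).
Qed.

Lemma esum_delta (R : realType) (T : choiceType) (t : T) (a : T -> R) :
  (forall x, 0 <= a x) ->
  (\esum_(y in [set: T]) (a y * (y == t)%:R)%:E = (a t)%:E)%E.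
Proof.
move=> a0; rewrite -[RHS](@esum_set1 R T t (fun y => (a y)%:E)) ?lee_fin//.
rewrite [RHS]esum_mkcond; apply: eq_esum => y _.
case: eqVneq => [->|/eqP yt]; first by rewrite mem_set// mulr1.
by rewrite memNset// mulr0.
Qed.

(** Finiteness of the sum of [a] allows it to be cancelled, so the non-negative terms [b x - a x]
    have sum at most 0. Equality of total flows or masses is turned into pointwise equality this
    way. *)
Lemma esum_eq_le (R : realType) (T : choiceType) (a b : T -> R) :
  (forall x, 0 <= a x) -> (forall x, a x <= b x) ->
  (\esum_(x in [set: T]) (b x)%:E <= \esum_(x in [set: T]) (a x)%:E)%E ->
  (\esum_(x in [set: T]) (a x)%:E < +oo)%E ->
  forall x, a x = b x.
Proof.
move=> a0 ab ba fin x.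
have ba0 y : (0 <= (b y - a y)%:E)%E by rewrite lee_fin subr_ge0.
have afin : \esum_(y in [set: T]) (a y)%:E \is a fin_num.
  by rewrite ge0_fin_numE// esum_ge0// => y _; rewrite lee_fin.
have : (\esum_(y in [set: T]) (b y - a y)%:E <= 0)%E.
  have := ba.
  rewrite (_ : \esum_(y in _) (b y)%:E =
     \esum_(y in [set: T]) ((b y - a y)%:E + (a y)%:E))%E; last first.
    by apply: eq_esum => y _; rewrite -EFinD subrK.
  by rewrite esumD//; [rewrite -leeBrDr// subee|move=> y _; rewrite lee_fin].
move=> h; apply/eqP; rewrite eq_le ab/= -subr_le0 -lee_fin.
apply: le_trans h; apply: esum_ge; exists [set x]; first by split.
by rewrite fsbig_set1.
Qed.

(** * Balance equations of a chain with bounded rates *)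

Section jump_chain.
Context {R : realType} {T : choiceType} {I : finType}.
Variables (r : I -> T -> R) (tr : I -> T -> T) (c : R).
Hypothesis r_ge0 : forall i x, 0 <= r i x.
Implicit Types (p f : T -> R) (x y : T).

Definition total_rate x : R := \sum_i r i x.

Definition inflow p y : \bar R :=
  (\esum_(x in [set: T]) (p x * \sum_(i | y == tr i x) r i x)%:E)%E.

Definition balanced p := forall y, inflow p y = (p y * total_rate y)%:E.

Hypothesis total_rate_le : forall x, total_rate x <= c.

Lemma total_rate_ge0 x : 0 <= total_rate x.
Proof. by apply: sumr_ge0. Qed.

Lemma inflow_ge0 p y : (forall x, 0 <= p x) -> (0 <= inflow p y)%E.
Proof.
by move=> p0; apply: esum_ge0 => x _; rewrite lee_fin mulr_ge0// sumr_ge0.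
Qed.

(** Tonelli: the flow is regrouped by source and move instead of by target. This is the balance
    equation tested against [f]. *)
Lemma inflow_test p f : (forall x, 0 <= p x) -> (forall x, 0 <= f x) ->
  (\esum_(y in [set: T]) ((f y)%:E * inflow p y) =
   \esum_(x in [set: T]) (p x * \sum_i r i x * f (tr i x))%:E)%E.
Proof.
move=> p0 f0; pose a y x := (f y * (p x * \sum_(i | y == tr i x) r i x))%:E.
have a0 y x : (0 <= a y x)%E by rewrite lee_fin !mulr_ge0// sumr_ge0.
rewrite [X in X = _](_ : _ = \esum_(y in [set: T]) \esum_(x in [set: T]) a y x)%E;
    last first.
  apply: eq_esum => y _; rewrite -esumZl//.
  by move=> x; rewrite lee_fin mulr_ge0// sumr_ge0.
rewrite exchange_esum//; apply: eq_esum => x _.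
rewrite (eq_esum (b := fun y => (\sum_i
    (f y * (p x * r i x) * (y == tr i x)%:R)%:E)%E)); last first.
  move=> y _; rewrite sumEFin; congr EFin.
  rewrite !mulr_sumr big_mkcond; apply: eq_bigr => i _.
  by case: ifP; rewrite (mulr1, mulr0).
rewrite esum_sum; last by move=> y i _ _; rewrite lee_fin !mulr_ge0.
rewrite mulr_sumr -sumEFin; apply: eq_bigr => i _.
by rewrite esum_delta => [|y]; [congr EFin; ring|rewrite !mulr_ge0].
Qed.

Lemma balanced_lyapunov p (Phi : T -> R) (a b : R) :
  (forall x, 0 <= p x) -> (\esum_(x in [set: T]) (p x)%:E = 1)%E ->
  balanced p -> (forall x, 0 <= Phi x) -> 0 < a -> 0 <= b ->
  (forall x, \sum_i r i x * (Phi (tr i x) - Phi x) <= b - a * Phi x) ->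
  (\esum_(x in [set: T]) (p x * Phi x)%:E <= (b / a)%:E)%E.
Proof.
move=> p0 p1 pbal Phi0 a0 b0 drift.
apply: ge_ereal_sup => _ [X [finX _] <-].
(* This level dominates [Phi] on the finite set [X], so truncating at [M] changes nothing there and
   no limit in [M] has to be taken. *)
pose M := \sum_(x <- fset_set X) Phi x.
have M0 : 0 <= M by exact: sumr_ge0.
pose f x := Num.min (Phi x) M; pose g x := if Phi x <= M then Phi x else 0.
have f0 x : 0 <= f x by rewrite le_min Phi0.
have g0 x : 0 <= g x by rewrite /g; case: ifP.
(* Below the level, truncation only lowers the values at the targets, so the drift condition
   survives. Above it, [f x] is already the maximum [M], so no move increases [f]. *)
have pointwise x :
    \sum_i r i x * f (tr i x) + a * g x <= total_rate x * f x + b.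
  rewrite /g /f; case: ifPn => [PhiM|]; last first.
    rewrite -ltNge => /ltW MPhi; rewrite mulr0 addr0 (min_r MPhi).
    rewrite ler_wpDr// mulr_suml ler_sum// => i _.
    by rewrite ler_wpM2l// ge_min lexx orbT.
  rewrite (min_l PhiM).
  have : \sum_i r i x * Num.min (Phi (tr i x)) M <= \sum_i r i x * Phi (tr i x).
    by apply: ler_sum => i _; rewrite ler_wpM2l// ge_min lexx.
  have := drift x; under eq_bigr do rewrite mulrBr.
  rewrite sumrB -mulr_suml -/(total_rate x); lra.
pose S := (\esum_(x in [set: T]) (p x * (total_rate x * f x))%:E)%E.
have c0 : 0 <= c.
  have [[x _] | noT] := pselect (exists x : T, True).
    by rewrite (le_trans _ (total_rate_le x))// total_rate_ge0.
  have : (\esum_(x in [set: T]) (p x)%:E = 0)%E.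
    by apply: esum1 => x; exfalso; apply: noT; exists x.
  by rewrite p1 => /eqP; rewrite onee_eq0.
have Sfin : S \is a fin_num.
  rewrite ge0_fin_numE; last first.
    by apply: esum_ge0 => x _; rewrite lee_fin !mulr_ge0// total_rate_ge0.
  apply: (@le_lt_trans _ _ (c * M)%:E); last exact: ltry.
  rewrite -[leRHS]mule1 -p1 -esumZl//; last by rewrite mulr_ge0.
  apply: le_esum => x _; rewrite -EFinM lee_fin mulrC ler_wpM2r//.
  by rewrite ler_pM// ?total_rate_ge0// ge_min lexx orbT.
(* By balance, the flow of [f] into the targets and out of the sources is the same finite number
   [S], which then cancels. *)
have ineq : (S + a%:E * (\esum_(x in [set: T]) (p x * g x)%:E) <= S + b%:E)%E.
  rewrite -[X in (_ <= _ + X)%E]mule1 -p1.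
  rewrite -esumZl; [|by move=> x; rewrite lee_fin mulr_ge0|exact: ltW].
  rewrite -esumZl//.
  have SE : S = (\esum_(x in [set: T]) (p x * \sum_i r i x * f (tr i x))%:E)%E.
    rewrite -inflow_test//; apply: eq_esum => x _.
    by rewrite pbal -EFinM; congr EFin; ring.
  rewrite {1}SE /S -esumD; last 2 first.
  - move=> x _; rewrite lee_fin mulr_ge0// sumr_ge0// => i _.
    by rewrite mulr_ge0.
  - by move=> x _; rewrite -EFinM lee_fin !mulr_ge0// ltW.
  rewrite -esumD; last 2 first.
  - by move=> x _; rewrite lee_fin !mulr_ge0// total_rate_ge0.
  - by move=> x _; rewrite -EFinM lee_fin mulr_ge0.
  apply: le_esum => x _; rewrite -!EFinM -!EFinD lee_fin.
  by rewrite (mulrCA a) (mulrC b) -!mulrDr ler_wpM2l.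
move: ineq; rewrite leeD2lE// => ineq.
rewrite mulrC EFinM lee_pdivlMl//; apply: le_trans ineq; rewrite lee_pmul2l//.
apply: esum_ge; exists X => //; rewrite fsbig_finite//= [leRHS]fsbig_finite//=.
rewrite !big_seq; apply: lee_sum => x xX; rewrite lee_fin ler_wpM2l// /g ifT//.
by rewrite /M (big_rem x)//= lerDl sumr_ge0.
Qed.

Lemma inflow_total p : (forall x, 0 <= p x) ->
  (\esum_(y in [set: T]) inflow p y =
   \esum_(x in [set: T]) (p x * total_rate x)%:E)%E.
Proof.
move=> p0; have := inflow_test p0 (fun=> ler01).
under eq_esum do rewrite mul1e; move=> ->.
by apply: eq_esum => x _; under eq_bigr do rewrite mulr1.
Qed.

Lemma inflow_ge p x i : (forall x, 0 <= p x) ->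
  ((p x * r i x)%:E <= inflow p (tr i x))%E.
Proof.
move=> p0; apply: esum_ge; exists [set x]; first by split.
rewrite fsbig_set1 lee_fin ler_wpM2l// (bigD1 i)//= lerDl.
by apply: sumr_ge0.
Qed.

(* The positive part of the difference of two balanced masses is subinvariant,
   hence invariant because its total flow is finite; so its support is closed
   under the moves of the chain. *)
Lemma balanced_excess p p' z (m : T -> nat) :
  (forall x, 0 <= p x) -> (forall x, 0 <= p' x) ->
  (\esum_(x in [set: T]) (p x)%:E = 1)%E ->
  balanced p -> balanced p' ->
  (forall x, x != z -> exists2 i, 0 < r i x & (m (tr i x) < m x)%N) ->
  (exists x, p' x < p x) -> p' z < p z.
Proof.
move=> p0 p'0 p1 pbal p'bal descent [x0 x0lt].
pose v x := Num.max (p x - p' x) 0.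
have v0 x : 0 <= v x by rewrite le_max lexx orbT.
have vp x : v x <= p x by rewrite ge_max p0 lerBlDr lerDl p'0.
have v_gt0 x : (0 < v x) = (p' x < p x) by rewrite lt_max ltxx orbF subr_gt0.
have inflow_le y : (inflow v y <= (p y * total_rate y)%:E)%E.
  rewrite -pbal; apply: le_esum => x _.
  by rewrite lee_fin ler_wpM2r// sumr_ge0.
have inflow_fin y : inflow v y \is a fin_num.
  by rewrite ge0_fin_numE ?inflow_ge0// (le_lt_trans (inflow_le y))// ltry.
(* Where [p] exceeds [p'], subtract the two balance equations and use [p x - p' x <= v x] in the
   inflow; elsewhere [v y = 0]. *)
have sub y : v y * total_rate y <= fine (inflow v y).
  rewrite -lee_fin fineK//; have [py|py] := leP (p y) (p' y).
    by rewrite /v max_r ?subr_le0// mul0r inflow_ge0.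
  rewrite [v y]max_l; last by rewrite subr_ge0 ltW.
  rewrite mulrBl EFinB leeBlDr// -pbal -p'bal.
  rewrite -esumD; last 2 first.
  - by move=> x _; rewrite lee_fin mulr_ge0// sumr_ge0.
  - by move=> x _; rewrite lee_fin mulr_ge0// sumr_ge0.
  apply: le_esum => x _; rewrite -EFinD lee_fin -mulrDl ler_wpM2r ?sumr_ge0//.
  by rewrite -lerBlDr le_max lexx.
(* Summed over [y], both sides give the same total flow, which is at most [c]. *)
have invariant y : v y * total_rate y = fine (inflow v y).
  apply: (@esum_eq_le R T (fun y => v y * total_rate y)
    (fun y => fine (inflow v y))) => //.
  - by move=> x; rewrite mulr_ge0// total_rate_ge0.
  - under eq_esum do rewrite fineK//.
    by rewrite inflow_total.
  - apply: (@le_lt_trans _ _ c%:E); last exact: ltry.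
    have c0 := le_trans (total_rate_ge0 x0) (total_rate_le x0).
    rewrite -[leRHS]mule1 -p1 -esumZl//.
    apply: le_esum => x _; rewrite -EFinM lee_fin mulrC.
    by rewrite ler_pM// total_rate_ge0.
have {x0lt}: 0 < v x0 by rewrite v_gt0.
have [k] := ubnP (m x0); elim: k x0 => // k IH x xk vx.
have [<-|xz] := eqVneq x z; first by rewrite -v_gt0.
have [i ri mi] := descent x xz.
apply: (IH (tr i x)); first exact: leq_trans mi _.
(* The positive flow from [x] into [tr i x] must be balanced by outflow, so [v] is positive at the
   target, where [m] is smaller. *)
have : 0 < v (tr i x) * total_rate (tr i x).
  rewrite invariant -lte_fin fineK//.
  apply: lt_le_trans (inflow_ge _ _ v0); rewrite lte_fin mulr_gt0//; exact: ri.
by rewrite lt0r mulf_eq0 negb_or -andbA lt0r v0 => /and3P[->].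
Qed.

(** An excess of [p] over [p'] anywhere forces one at [z], and symmetrically. The two cannot hold at
    [z] together, so one mass dominates the other pointwise, and equal totals make them equal. *)
Lemma balanced_unique p p' z (m : T -> nat) :
  (forall x, 0 <= p x) -> (forall x, 0 <= p' x) ->
  (\esum_(x in [set: T]) (p x)%:E = 1)%E ->
  (\esum_(x in [set: T]) (p' x)%:E = 1)%E ->
  balanced p -> balanced p' ->
  (forall x, x != z -> exists2 i, 0 < r i x & (m (tr i x) < m x)%N) ->
  p =1 p'.
Proof.
move=> p0 p'0 p1 p'1 pbal p'bal descent.
have le_eq (q q' : T -> R) : (forall x, 0 <= q x) -> (forall x, q x <= q' x) ->
    (\esum_(x in [set: T]) (q x)%:E = 1)%E ->
    (\esum_(x in [set: T]) (q' x)%:E = 1)%E -> q =1 q'.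
  move=> q0 qq' q1 q'1 x.
  by apply: (@esum_eq_le R T q q') => //; rewrite q1 ?q'1// ltry.
have [pp'|p'p] := pselect (exists x, p' x < p x).
- have z_lt := balanced_excess p0 p'0 p1 pbal p'bal descent pp'.
  move=> x; symmetry; apply: le_eq => // y; rewrite leNgt; apply/negP => y_lt.
  have z_gt : p z < p' z.
    by apply: balanced_excess p'0 p0 p'1 p'bal pbal descent _; exists y.
  by have := lt_trans z_lt z_gt; rewrite ltxx.
- apply: le_eq => // y; rewrite leNgt; apply/negP => y_lt.
  by apply: p'p; exists y.
Qed.

End jump_chain.

(** * From the semigroup to the balance equations *)

Lemma integral_singleton (d : measure_display) (S : measurableType d)
    (R : realType) (mu : {measure set S -> \bar R}) (x : S) (f : S -> \bar R) :
  measurable [set x] ->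
  (\int[mu]_(y in [set x]) f y = f x * mu [set x])%E.
Proof.
move=> mx; rewrite -(integral_cst mu mx (f x)).
by apply: eq_integral => y /set_mem ->.
Qed.

Section discrete_semigroup.
Context {d : measure_display} {S : measurableType d} {R : realType}.
Variable P : R -> R.-pker S ~> S.
Hypothesis semigroup : markov_semigroup P.
Hypothesis discrete : forall A : set S, measurable A.
Implicit Types (x y : S) (s t h : R).

Definition transition t x y : R := fine (P t x [set y]).

Lemma measurable_discrete d' (U : sigmaRingType d') (f : S -> U) :
  measurable_fun [set: S] f.
Proof. by move=> _ B _; apply: discrete. Qed.

Lemma transitionE t x y : (transition t x y)%:E = P t x [set y].
Proof. by rewrite fineK// finite_kernel_measure. Qed.

Lemma transition_ge0 t x y : 0 <= transition t x y.
Proof. exact: fine_ge0. Qed.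

Lemma transition_le_compl t x y :
  x != y -> transition t x y <= 1 - transition t x x.
Proof.
move=> xy; rewrite lerBrDr -lee_fin EFinD !transitionE.
rewrite -measureU//; last first.
  by apply/seteqP; split=> // z [/= -> yx]; rewrite yx eqxx in xy.
by rewrite -(prob_kernel (s := P t) x) le_measure//; exact/mem_set/discrete.
Qed.

Lemma transition_le1 t x y : transition t x y <= 1.
Proof.
rewrite -lee_fin transitionE -(prob_kernel (s := P t) x).
by rewrite le_measure//; exact/mem_set/discrete.
Qed.

(** In the Chapman-Kolmogorov integral, only the intermediate state [x] is kept. *)
Lemma transition_hold s t x : 0 <= s -> 0 <= t ->
  transition s x x * transition t x x <= transition (s + t) x x.
Proof.
move=> s0 t0; rewrite -lee_fin EFinM !transitionE.
rewrite (semigroup.2 s t x)// muleC.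
rewrite -(integral_singleton (P s x) (fun y => P t y [set x]))//.
by apply: ge0_subset_integral.
Qed.

Lemma escape_natmul h x k : 0 <= h ->
  1 - transition (k%:R * h) x x <= k%:R * (1 - transition h x x).
Proof.
move=> h0; elim: k => [|k IH].
  rewrite !mul0r subr_le0 -lee_fin transitionE semigroup.1//.
  by rewrite diracE mem_set.
have := transition_hold x (mulr_ge0 (ler0n R k) h0) h0.
have -> : k%:R * h + h = k.+1%:R * h by rewrite -natr1 mulrDl mul1r.
have : 0 <= (1 - transition (k%:R * h) x x) * (1 - transition h x x).
  by rewrite mulr_ge0// subr_ge0 transition_le1.
by move: IH; rewrite -natr1; nra.
Qed.

(** Cut [[0, t]] into [k + 1] equal steps; by [escape_natmul] the escape probability is at most
    [k + 1] times that of one step, which tends to [t * q]. The bound holds for every positive [t],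
    not just asymptotically, which is what domination requires. *)
Lemma escape_le (q : R) t x : 0 < t ->
  (transition h x x - 1) / h @[h --> 0^'+] --> - q ->
  1 - transition t x x <= t * q.
Proof.
move=> t0 /cvg_at_rightP lim_q.
pose h k : R := t * k.+1%:R^-1.
have h0 k : 0 < h k by rewrite mulr_gt0.
have hlim : h @ \oo --> (0 : R).
  by rewrite -(mulr0 t); apply: cvgMl_tmp; exact: cvg_harmonic.
have {}lim_q := lim_q h (conj h0 hlim).
rewrite -[q]opprK mulrN -mulNr.
apply: (cvgr_to_ge (cvgMl_tmp (a := - t) lim_q)).
apply: nearW => k.
have -> : - t * ((transition (h k) x x - 1) / h k) =
    k.+1%:R * (1 - transition (h k) x x).
  by rewrite /h; field; rewrite nat1r pnatr_eq0/= (gt_eqF t0).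
rewrite -{1}(_ : k.+1%:R * h k = t); first by rewrite escape_natmul// ltW.
by rewrite /h; field; rewrite nat1r pnatr_eq0.
Qed.

Variables (Q : S -> S -> R) (pi : probability S R) (c : R).
Hypothesis rates : forall x y,
  (transition t x y - (x == y)%:R) / t @[t --> 0^'+] --> Q x y.
Hypothesis rates_le : forall x, - Q x x <= c.
Hypothesis pi_stationary : stationary P pi.

Lemma transition_lipschitz t x y : 0 < t ->
  `|transition t x y - (x == y)%:R| <= t * c.
Proof.
move=> t0; have esc : 1 - transition t x x <= t * c.
  apply: (@le_trans _ _ (t * - Q x x)); last by rewrite ler_pM2l.
  apply: escape_le => //; have := @rates x x.
  by rewrite eqxx opprK.
apply: le_trans esc; case: eqVneq => [<-|xy].
  by rewrite distrC ger0_norm// subr_ge0 transition_le1.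
by rewrite subr0 ger0_norm ?transition_ge0// transition_le_compl.
Qed.

(** Stationarity makes the integral of every difference quotient vanish. The quotients are bounded
    by [c] through [transition_lipschitz], so dominated convergence passes to the rates. *)
Lemma stationary_generator y : (\int[pi]_x (Q x y)%:E = 0)%E.
Proof.
pose f k x : \bar R :=
  ((transition k.+1%:R^-1 x y - (x == y)%:R) / k.+1%:R^-1)%:E.
have int_bounded (g : S -> R) (b : R) : (forall x, `|g x| <= b) ->
    pi.-integrable [set: S] (EFin \o g).
  move=> gb; have := finite_measure_integrable_cst pi b measurableT.
  apply: le_integrable => // x _ /=.
  by rewrite lee_fin (le_trans (gb x))// ler_norm.
have f0 k : (\int[pi]_x f k x = 0)%E.
  rewrite /f; under eq_integral do rewrite mulrC EFinM.
  rewrite integralZl//; last first.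
    apply: (int_bounded _ (k.+1%:R^-1 * c)) => x.
    exact: transition_lipschitz.
  under eq_integral do rewrite EFinB.
  rewrite integralB//; last 2 first.
  - apply: (int_bounded _ 1) => x.
    by rewrite ger0_norm ?transition_ge0// transition_le1.
  - by apply: (int_bounded _ 1) => x; case: eqP; rewrite ?normr1 ?normr0.
  under eq_integral do rewrite transitionE.
  rewrite pi_stationary//.
  rewrite (eq_integral (fun x => (\1_[set y] x)%:E)); last first.
    by move=> x _; rewrite indicE in_set1.
  by rewrite integral_indic// setIT subee ?mule0// fin_num_measure.
have [|||||_ _] := @dominated_convergence _ _ R pi setT measurableT f
  (fun x => (Q x y)%:E) (fun=> c%:E).
- by move=> k; exact: measurable_discrete.
- exact: measurable_discrete.
- apply: aeW => x _; apply: cvg_EFin; first exact: nearW.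
  have /cvg_at_rightP := @rates x y; apply; split; first by [].
  exact: cvg_harmonic.
- exact: finite_measure_integrable_cst.
- apply: aeW => x k _; rewrite lee_fin invrK normrM normr_nat.
  rewrite -ler_pdivlMr// mulrC.
  exact: transition_lipschitz.
by under eq_fun do rewrite f0; move=> /cvg_lim <- //; rewrite lim_cst.
Qed.

End discrete_semigroup.

(** The fibres of the injective [code] partition the space into countably many pieces, each empty or
    a singleton. *)
Lemma integral_esum (d : measure_display) (S : measurableType d) (R : realType)
    (mu : {measure set S -> \bar R}) (code : S -> nat) (f : S -> \bar R) :
  (forall A : set S, measurable A) -> injective code ->
  (forall x, 0 <= f x)%E ->
  (\int[mu]_x f x = \esum_(x in [set: S]) (f x * mu [set x]))%E.
Proof.
move=> discrete code_inj f0; pose F k := code @^-1` [set k].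
have tF : trivIset setT F.
  by move=> i j _ _ [x [/= <- <-]].
have FT : \bigcup_k F k = [set: S].
  by apply/seteqP; split=> // x _; exists (code x).
have fmu0 x : (0 <= f x * mu [set x])%E by rewrite mule_ge0.
rewrite -[in RHS]FT esum_bigcupT// -nneseries_esumT; last first.
  by move=> k; exact: esum_ge0.
rewrite -{1}FT ge0_integral_bigcup//.
apply: eq_eseriesr => k _.
have [[x xk]|noF] := pselect (exists x, F k x); last first.
  have -> : F k = set0 by apply/seteqP; split=> // x xk; apply: noF; exists x.
  by rewrite integral_set0 esum_set0.
have -> : F k = [set x].
  by apply/seteqP; split=> [y yk|y -> //]; apply: code_inj; rewrite yk xk.
by rewrite integral_singleton// esum_set1.
Qed.

(** The generator is split into a jump part [J] and an exit part [E]. Both lie between 0 and [c], so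
    they are integrable separately; equality of their integrals is the balance equation at [y]. *)
Lemma stationary_balanced (d : measure_display) (S : measurableType d)
    (R : realType) (I : finType) (r : I -> S -> R) (tr : I -> S -> S) (c : R)
    (code : S -> nat) (P : R -> R.-pker S ~> S) (pi : probability S R) :
  (forall A : set S, measurable A) -> injective code ->
  (forall i x, 0 <= r i x) -> (forall x, total_rate r x <= c) ->
  markov_semigroup P ->
  (forall x y, (transition P t x y - (x == y)%:R) / t @[t --> 0^'+] -->
     \sum_(i | y == tr i x) r i x - (if x == y then total_rate r x else 0)) ->
  stationary P pi ->
  balanced r tr (fun x => fine (pi [set x])).
Proof.
move=> discrete code_inj r0 rc semigroup rates pi_stat y.
pose J x := \sum_(i | y == tr i x) r i x.
pose E x := if x == y then total_rate r x else 0.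
have J0 x : 0 <= J x by exact: sumr_ge0.
have tot0 x : 0 <= total_rate r x by exact: sumr_ge0.
have E0 x : 0 <= E x by rewrite /E; case: ifP.
have Ec x : E x <= c by rewrite /E; case: ifP; rewrite // (le_trans (tot0 x)).
have Jc x : J x <= c.
  by apply: le_trans (rc x); rewrite /J big_mkcond ler_sum// => i _; case: ifP.
have integ (g : S -> R) : (forall x, 0 <= g x) -> (forall x, g x <= c) ->
    pi.-integrable [set: S] (EFin \o g).
  move=> g0 gc; have := finite_measure_integrable_cst pi c measurableT.
  apply: le_integrable => // x _ /=.
  by rewrite lee_fin ger0_norm// (le_trans (gc x))// ler_norm.
have rates_le x : - (\sum_(i | x == tr i x) r i x -
    (if x == x then total_rate r x else 0)) <= c.
  by rewrite eqxx opprB (le_trans _ (rc x))// gerBl sumr_ge0.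
have := stationary_generator semigroup discrete rates rates_le pi_stat y.
under eq_integral do rewrite EFinB.
rewrite integralB//; [|exact: integ|exact: integ].
have fin g : (forall x, 0 <= g x) -> (forall x, g x <= c) ->
    (\int[pi]_x (g x)%:E \is a fin_num)%E.
  by move=> g0 gc; apply: integrable_fin_num => //; exact: integ.
move/eqP; rewrite sube_eq ?fin// add0e => /eqP JE.
rewrite /inflow (eq_esum (b := fun x => ((J x)%:E * pi [set x])%E)).
  rewrite -(integral_esum _ discrete code_inj) ?JE//.
  rewrite (integral_esum _ discrete code_inj)//.
  rewrite (eq_esum (b := fun x =>
      ((fine (pi [set x]) * total_rate r x) * (x == y)%:R)%:E)).
    rewrite esum_delta// => x; by rewrite mulr_ge0// fine_ge0.
  move=> x _; rewrite -[X in (_ * X)%E = _]fineK ?fin_num_measure// -EFinM /E.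
  congr EFin.
  by case: eqP; rewrite ?mul0r ?mulr0// mulr1 mulrC.
move=> x _; rewrite -[X in (_ * X)%E]fineK ?fin_num_measure// -EFinM mulrC.
by [].
Qed.

(** * Exponential inequalities *)

Lemma mul1B_expR_le1 (R : realType) (x : R) : (1 - x) * expR x <= 1.
Proof.
by rewrite -[leRHS](expRxMexpNx_1 x) mulrC ler_wpM2l ?expR_ge0// expR_ge1Dx.
Qed.

(** Multiplying by [1 - x > 0], the right side becomes [1 + x^2 (1 - 2 x) >= 1], while the left side
    is at most 1. *)
Lemma expR_le_quadratic (R : realType) (x : R) :
  x <= 2^-1 -> expR x <= 1 + x + 2 * x ^+ 2.
Proof. by have := mul1B_expR_le1 x; have := expR_gt0 x; nra. Qed.

(** Convexity on [[0, M]], cleared of the denominator [M]. It is the combination of the tangent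
    bounds for [expR (- w)] and [expR (M - w)] with weights [M - w] and [w]. *)
Lemma expR_chord (R : realType) (M w : R) :
  0 <= w -> w <= M -> M * expR w <= (M - w) + w * expR M.
Proof.
move=> w0 wM; have h1 := mul1B_expR_le1 w.
have : expR w * (1 + (M - w)) <= expR M.
  have -> : expR M = expR w * expR (M - w) by rewrite -expRD; congr expR; ring.
  by rewrite ler_wpM2l ?expR_ge0// expR_ge1Dx.
have := expR_gt0 w; nra.
Qed.

(* The multiplier [c] of [u] is irrelevant once the inequality is summed over
   values [u] with zero sum. *)
Lemma expR_asymmetry (R : realType) (M : R) : 0 <= M ->
  exists c, forall u, - M <= u ->
    0 <= expR u / 2 - 3 / 2 * expR (- u) + c * u + expR M - expR (- M) + 3.
Proof.
move=> M0.
have Y1 : 1 <= expR M by rewrite -expR0 ler_expR.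
have z1 : expR (- M) <= 1 by rewrite -expR0 ler_expR oppr_le0.
(* For [M <= 1], the bounds [expR (- u) <= expR M <= 4] and [expR (- M) <= 1] suffice without a
   linear term: [- 4 / 2 - 1 + 3 = 0]. *)
have [M1|M1] := leP M 1.
  exists 0 => u uM; rewrite mul0r addr0.
  have : expR (- u) <= expR M by rewrite ler_expR lerNl.
  have := expR_gt0 u.
  have : expR M <= 4.
    have -> : M = M / 2 + M / 2 by field.
    have : expR (M / 2) <= 2.
      apply: le_trans (expR_le_quadratic _) _; first by lra.
      by rewrite expr2; nra.
    by have := expR_gt0 (M / 2); rewrite expRD; nra.
  lra.
(* With [v = - u / M], the linear term is [expR M * v / 2]. For [u <= 0] the chord bound costs
   [3 / 2 * v * expR M]; the linear term reduces this to [v * expR M], which [expR M] pays for since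
   [v <= 1]. *)
exists (- (expR M / (2 * M))) => u uM.
have -> : - (expR M / (2 * M)) * u = expR M / 2 * (- u / M).
  by field; rewrite gt_eqF// (lt_trans ltr01).
have M_gt0 : 0 < M by exact: lt_trans M1.
have eu := expR_gt0 u.
have [u0|u0] := leP u 0.
  have : M * expR (- u) <= (M - - u) + - u * expR M.
    by apply: expR_chord; lra.
  rewrite -ler_pdivlMl//.
  have -> : M^-1 * (M - - u + - u * expR M) = 1 - (- u / M) + (- u / M) * expR M.
    by field; rewrite gt_eqF.
  have : - u / M <= 1 by rewrite ler_pdivrMr// mul1r lerNl.
  have : 0 <= - u / M by rewrite divr_ge0 ?oppr_ge0// ltW.
  by nra.
have : expR (- u) <= 1 by rewrite -expR0 ler_expR oppr_le0 ltW.
set v := - u / M.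
have [uM'|uM'] := leP u M.
  have : -1 <= v by rewrite /v mulNr lerN2 ler_pdivrMr// mul1r.
  nra.
(* Beyond [M] the linear term may fall below [- expR M / 2]. As [M > 1], [u / M <= 1 + (u - M)], so
   half of [expR u] compensates for it. *)
have : expR M * (1 + (u - M)) <= expR u.
  rewrite -[X in _ <= expR X](subrK M) [leRHS]expRD mulrC ler_pM2r ?expR_gt0//.
  exact: expR_ge1Dx.
have : - (1 + (u - M)) <= v.
  rewrite /v mulNr lerN2 ler_pdivrMr//; nra.
nra.
Qed.

(** Summing [expR_asymmetry] removes the linear terms. With [- M] the least value of [s], this is
    the bound [D >= Phi / 2 - 3 n]. *)
Lemma sum_expR_asymmetry (R : realType) (I : finType) (s : I -> R) (M : R) :
  0 <= M -> \sum_i s i = 0 -> (forall i, - M <= s i) ->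
  (\sum_i expR (s i) + \sum_i expR (- s i)) / 2 - 3 * #|I|%:R <=
  \sum_i expR (s i) - #|I|%:R * expR (- M) +
  (#|I|%:R * expR M - \sum_i expR (- s i)).
Proof.
move=> M0 s0 sM; have [c cP] := expR_asymmetry M0.
have [K KE] : exists K, K = expR M - expR (- M) + 3 by eexists.
have : 0 <= \sum_i (expR (s i) / 2 - 3 / 2 * expR (- s i) + c * s i + K).
  by apply: sumr_ge0 => i _; have := cP _ (sM i); rewrite KE; lra.
rewrite !big_split/= -mulr_suml -mulr_sumr s0 sumrN -mulr_sumr.
by rewrite sumr_const -[K *+ _]mulr_natl KE; lra.
Qed.

(** A job entering or leaving queue [k] shifts every deviation by [(i == k) - 1 / n] up to sign. The
    condition on [w] keeps all increments of the exponents in the range of [expR_le_quadratic]. *)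
Lemma sum_expR_shift_le (R : realType) (n : nat) (s : 'I_n -> R) (k : 'I_n)
    (t w : R) : `|w| <= 2^-1 ->
  \sum_i expR (t * s i + w * ((i == k)%:R - n%:R^-1)) <=
  (\sum_i expR (t * s i)) * (1 - w / n%:R + 2 * w ^+ 2 / n%:R) +
  expR (t * s k) * (w + 2 * w ^+ 2).
Proof.
move=> w2; have n0 : (0 < n)%N by case: (n) k => // -[].
have v0 : 0 < n%:R^-1 :> R by rewrite invr_gt0 ltr0n.
have v1 : n%:R^-1 <= 1 :> R by rewrite invf_le1 ?ltr0n// ler1n.
have [wlo whi] : - 2^-1 <= w /\ w <= 2^-1.
  by apply/andP; rewrite -ler_norml.
move: v0 v1; set v := n%:R^-1 => v0 v1.
have wv_lo : - 2^-1 <= w * v by nra.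
have wv_hi : w * v <= 2^-1 by nra.
have step i : expR (t * s i + w * ((i == k)%:R - v)) <=
    expR (t * s i) * (1 - w * v + 2 * w ^+ 2 * v) +
    (if i == k then expR (t * s k) * (w + 2 * w ^+ 2) else 0).
  rewrite expRD; have e0 := expR_gt0 (t * s i).
  have w_sq := sqr_ge0 w.
  case: eqVneq => [->|ik] /=; last first.
    rewrite addr0 ler_wpM2l ?expR_ge0// sub0r.
    apply: le_trans (expR_le_quadratic _) _; first by lra.
    rewrite mulrN sqrrN exprMn; nra.
  rewrite -mulrDr ler_wpM2l ?expR_ge0//.
  apply: le_trans (expR_le_quadratic _) _; first by nra.
  rewrite exprMn; have : (1 - v) ^+ 2 <= 1 by rewrite expr2; nra.
  nra.
apply: le_trans (ler_sum _ (fun i _ => step i)) _.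
by rewrite big_split/= -mulr_suml -big_mkcond/= big_pred1_eq.
Qed.

(* [U], [V] are the sums of [expR (theta * s i)] and [expR (- theta * s i)],
   [Y] and [z] the value of the largest summand of [V] and its inverse, [e]
   is the load, and [j] the fraction of idle servers. *)
Lemma drift_arith (R : realType) (n U V Y z e j theta : R) :
  0 < n -> 0 <= z -> 0 <= Y -> n * z <= U -> V <= n * Y -> 0 <= V ->
  2^-1 <= e -> e <= 1 -> 0 <= j -> j <= 1 -> 0 < theta -> theta < 96^-1 ->
  (U + V) / 2 - 3 * n <= U - n * z + (n * Y - V) ->
  e * (n * z * (theta + 2 * theta ^+ 2) + U * (- theta + 2 * theta ^+ 2) +
       n * Y * (- theta + 2 * theta ^+ 2) + V * (theta + 2 * theta ^+ 2)) +
  ((U - j * n * z) * (- theta + 2 * theta ^+ 2) +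
   (1 - j) * U * (theta + 2 * theta ^+ 2) +
   (V - j * n * Y) * (theta + 2 * theta ^+ 2) +
   (1 - j) * V * (- theta + 2 * theta ^+ 2)) <=
  theta * (2 * n - (U + V) / 8).
Proof.
move=> n0 z0 Y0 nzU VnY V0 e2 e1 j0 j1 th0 th1 asym.
set D := U - n * z + (n * Y - V) in asym.
pose C := e * (n * z + U + n * Y + V) + (U - j * n * z) + (1 - j) * U +
  (V - j * n * Y) + (1 - j) * V.
(* Separation by order in [theta]: [D] carries the first-order terms, [C] the second-order ones. *)
rewrite [leLHS](_ : _ = theta * (- (e + j) * D + 2 * theta * C)); last first.
  by rewrite /C /D; ring.
rewrite ler_pM2l//.
have D0 : 0 <= D by rewrite /D; lra.
have U0 : 0 <= U by apply: le_trans nzU; rewrite mulr_ge0// ltW.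
have jz0 : 0 <= j * n * z by rewrite !mulr_ge0// ltW.
have jY0 : 0 <= j * n * Y by rewrite !mulr_ge0// ltW.
have CD : C <= e * D + 4 * (U + V).
  have : e * (n * z + U + n * Y + V) <= e * (2 * U + 2 * V + D).
    by apply: ler_wpM2l; [lra|rewrite /D; lra].
  rewrite /C; nra.
have : 2 * theta * C <= 2 * 96^-1 * (e * D + 4 * (U + V)).
  have W0 : 0 <= e * D + 4 * (U + V).
    by rewrite addr_ge0 ?mulr_ge0//; lra.
  apply: le_trans (_ : 2 * theta * (e * D + 4 * (U + V)) <= _).
    by rewrite ler_pM2l// mulr_gt0.
  by rewrite ler_wpM2r//; lra.
(* What is left is at most [- (47 / 96) D + (U + V) / 12]; inserting the lower bound on [D] gives
   [- (31 / 192) (U + V) + (47 / 32) n], within the claim. *)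
have : e * D >= 2^-1 * D by rewrite ler_wpM2r.
have : 0 <= j * D by rewrite mulr_ge0.
rewrite mulNr mulrDl; lra.
Qed.

(** * The join-the-shortest-queue chain *)

Section jsq_chain.
Context {R : realType} {n : nat}.
Variables (lambda mu : R).
Implicit Types (q : queues n) (k : 'I_n + 'I_n) (i j : 'I_n).

Definition jsq_rate k q : R :=
  match k with
  | inl i => arrival_rate lambda q i
  | inr i => departure_rate mu q i
  end.

Definition jsq_move k q : queues n :=
  match k with inl i => arrive q i | inr i => depart q i end.

Lemma jump_rateE q q' :
  jump_rate lambda mu q q' = \sum_(k | q' == jsq_move k q) jsq_rate k q.
Proof. by rewrite big_sumType. Qed.

Lemma exit_rateE q : exit_rate lambda mu q = total_rate jsq_rate q.
Proof. by rewrite /total_rate big_sumType. Qed.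

Lemma shortest_exists q : (0 < n)%N -> exists i, i \in shortest q.
Proof.
move=> n0; pose i0 := Ordinal n0.
case: (@arg_minnP _ i0 xpredT (fun i => q i)) => // i _ imin.
by exists i; rewrite inE; apply/forallP => j; apply: imin.
Qed.

Lemma sum_arrival_rate q : (0 < n)%N -> \sum_i arrival_rate lambda q i = lambda.
Proof.
move=> n0; have [i0 i0s] := shortest_exists q n0.
rewrite -big_mkcond sumr_const -[LHS]mulr_natr divfK// pnatr_eq0 -lt0n.
by apply/card_gt0P; exists i0.
Qed.

Hypotheses (lambda0 : 0 <= lambda) (mu0 : 0 <= mu).

Lemma jsq_rate_ge0 k q : 0 <= jsq_rate k q.
Proof.
case: k => i /=; first by rewrite /arrival_rate; case: ifP; rewrite ?divr_ge0.
by rewrite /departure_rate; case: ifP.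
Qed.

Lemma total_jsq_rate_le q :
  (0 < n)%N -> total_rate jsq_rate q <= lambda + mu * n%:R.
Proof.
move=> n0; rewrite -exit_rateE /exit_rate sum_arrival_rate// lerD2l.
apply: (@le_trans _ _ (\sum_(i < n) mu)).
  by apply: ler_sum => i _; rewrite /departure_rate; case: ifP.
by rewrite sumr_const card_ord mulr_natr.
Qed.

End jsq_chain.

(** * Deviations from the mean queue length *)

Section q_perp.
Context {R : realType} {n : nat}.
Implicit Types (q : queues n) (i k : 'I_n).

Lemma sum_q_perp q : \sum_i q_perp R q i = 0.
Proof.
case: n q => [|m] q; first by rewrite big_ord0.
rewrite sumrB sumr_const card_ord -[X in _ - X]mulr_natl mulrA mulfV ?pnatr_eq0//.
by rewrite mul1r subrr.
Qed.

Lemma q_perp_arrive q k i :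
  q_perp R (arrive q k) i = q_perp R q i + ((i == k)%:R - n%:R^-1).
Proof.
rewrite /q_perp ffunE natrD.
under eq_bigr do rewrite ffunE natrD.
have -> : \sum_(j < n) ((q j)%:R + (j == k)%:R) = \sum_(j < n) (q j)%:R + 1 :> R.
  rewrite big_split/=; congr (_ + _); rewrite (bigD1 k)//= eqxx big1 ?addr0//.
  by move=> j /negPf ->.
by ring.
Qed.

Lemma q_perp_depart q k i : (0 < q k)%N ->
  q_perp R (depart q k) i = q_perp R q i - ((i == k)%:R - n%:R^-1).
Proof.
move=> qk; have {2}-> : q = arrive (depart q k) k.
  apply/ffunP => l; rewrite !ffunE.
  by case: eqP => [->|_]; rewrite ?subn0 ?addn0 ?subnK.
by rewrite q_perp_arrive addrK.
Qed.

Lemma q_perp_min q k i : k \in shortest q -> q_perp R q k <= q_perp R q i.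
Proof. by rewrite inE => /forallP/(_ i) qki; rewrite lerD2r ler_nat. Qed.

Lemma q_perp_shortest q k k' : k \in shortest q -> k' \in shortest q ->
  q_perp R q k = q_perp R q k'.
Proof. by move=> ks k's; apply/eqP; rewrite eq_le !q_perp_min. Qed.

End q_perp.

(** * Drift of the exponential Lyapunov function *)

Section drift.
Context {R : realType} {n : nat}.
Variable theta : R.
Implicit Types (q : queues n) (i k : 'I_n).

Definition perp_lyapunov q : R :=
  \sum_(i < n) expR (- theta * q_perp R q i)
  + \sum_(i < n) expR (theta * q_perp R q i).

Hypotheses (theta0 : 0 < theta) (theta1 : theta < 96^-1).

Let U q : R := \sum_(i < n) expR (theta * q_perp R q i).
Let V q : R := \sum_(i < n) expR (- theta * q_perp R q i).
(** [cp] and [cn] are the quadratic upper bounds for [expR theta - 1] and [expR (- theta) - 1]. *)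
Let cp : R := theta + 2 * theta ^+ 2.
Let cn : R := - theta + 2 * theta ^+ 2.

Let theta_half : `|theta| <= 2^-1.
Proof.
rewrite ger0_norm; last exact: ltW.
by move: theta1; lra.
Qed.

Lemma perp_lyapunov_arrive q k :
  perp_lyapunov (arrive q k) - perp_lyapunov q <=
  expR (theta * q_perp R q k) * cp + U q * cn / n%:R +
  expR (- theta * q_perp R q k) * cn + V q * cp / n%:R.
Proof.
have Nhalf : `|- theta| <= 2^-1 by rewrite normrN.
have arriveE t :
    \sum_i expR (t * q_perp R q i + t * ((i == k)%:R - n%:R^-1)) =
    \sum_i expR (t * q_perp R (arrive q k) i).
  by apply: eq_bigr => i _; rewrite q_perp_arrive -mulrDr.
have := sum_expR_shift_le (q_perp R q) k theta theta_half.
have := sum_expR_shift_le (q_perp R q) k (- theta) Nhalf.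
rewrite /perp_lyapunov sqrrN.
rewrite (arriveE theta) (arriveE (- theta)).
rewrite -/(U q) -/(V q) /cp /cn; lra.
Qed.

Lemma perp_lyapunov_depart q k : (0 < q k)%N ->
  perp_lyapunov (depart q k) - perp_lyapunov q <=
  expR (theta * q_perp R q k) * cn + expR (- theta * q_perp R q k) * cp +
  (U q * cp + V q * cn) / n%:R.
Proof.
move=> qk; have Nhalf : `|- theta| <= 2^-1 by rewrite normrN.
have departE t :
    \sum_i expR (t * q_perp R q i + - t * ((i == k)%:R - n%:R^-1)) =
    \sum_i expR (t * q_perp R (depart q k) i).
  by apply: eq_bigr => i _; rewrite q_perp_depart// mulNr -mulrBr.
have := sum_expR_shift_le (q_perp R q) k (- theta) theta_half.
have := sum_expR_shift_le (q_perp R q) k theta Nhalf.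
rewrite /perp_lyapunov sqrrN.
rewrite (departE theta).
have := departE (- theta); rewrite opprK => ->.
rewrite -/(U q) -/(V q) /cp /cn; lra.
Qed.

Lemma perp_lyapunov_drift (mu e : R) q :
  (0 < n)%N -> 0 < mu -> 2^-1 <= e -> e <= 1 ->
  \sum_k jsq_rate (n%:R * mu * e) mu k q *
    (perp_lyapunov (jsq_move k q) - perp_lyapunov q) <=
  mu * theta * (2 * n%:R - perp_lyapunov q / 8).
Proof.
move=> n0 mu0 e2 e1; have n_gt0 : 0 < n%:R :> R by rewrite ltr0n.
have [k0 k0s] := shortest_exists q n0.
pose z := expR (theta * q_perp R q k0).
pose Y := expR (- theta * q_perp R q k0).
have zE k : k \in shortest q -> expR (theta * q_perp R q k) = z.
  by move=> ks; rewrite (q_perp_shortest ks k0s).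
have YE k : k \in shortest q -> expR (- theta * q_perp R q k) = Y.
  by move=> ks; rewrite (q_perp_shortest ks k0s).
(* An idle queue has length 0 and is therefore shortest. All idle queues thus contribute the common
   values [z] and [Y], and sums over busy queues become full sums with a correction. *)
have idle_shortest i : ~~ (0 < q i)%N -> i \in shortest q.
  by rewrite -eqn0Ngt => /eqP qi; rewrite inE qi; apply/forallP.
pose idle := #|[pred i | ~~ (0 < q i)%N]|.
have sum_busy (f : 'I_n -> R) (y : R) : (forall i, i \in shortest q -> f i = y) ->
    \sum_(i | (0 < q i)%N) f i = \sum_i f i - idle%:R * y.
  move=> fy; rewrite [in RHS](bigID (fun i => 0 < q i)%N)/=.
  have -> : \sum_(i | ~~ (0 < q i)%N) f i = idle%:R * y.
    rewrite mulr_natl -sumr_const; apply: eq_bigr => i qi.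
    by apply: fy; apply: idle_shortest.
  by rewrite addrK.
have busyE : #|[pred i | (0 < q i)%N]|%:R = n%:R - idle%:R :> R.
  have := sum_busy (fun=> 1) 1 (fun _ _ => erefl).
  by rewrite !sumr_const card_ord mulr1.
pose Ga := z * cp + U q * cn / n%:R + Y * cn + V q * cp / n%:R.
pose H := (U q * cp + V q * cn) / n%:R.
have arrivals : \sum_i arrival_rate (n%:R * mu * e) q i *
    (perp_lyapunov (arrive q i) - perp_lyapunov q) <= n%:R * mu * e * Ga.
  rewrite -[X in X * Ga](sum_arrival_rate _ q n0) mulr_suml.
  apply: ler_sum => i _; rewrite /arrival_rate; case: ifP => [si|_]; last first.
    by rewrite !mul0r.
  apply: ler_wpM2l; first by rewrite !mulr_ge0 ?invr_ge0//; lra.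
  by rewrite /Ga -(zE i)// -(YE i)// perp_lyapunov_arrive.
have departures : \sum_i departure_rate mu q i *
    (perp_lyapunov (depart q i) - perp_lyapunov q) <=
    mu * ((U q - idle%:R * z) * cn + (V q - idle%:R * Y) * cp +
          (n%:R - idle%:R) * H).
  rewrite -(sum_busy _ _ zE) -(sum_busy _ _ YE) -busyE mulr_natl -sumr_const.
  rewrite !mulr_suml -!big_split/= mulr_sumr [leRHS]big_mkcond/=.
  apply: ler_sum => i _; rewrite /departure_rate; case: ifP => [qi|_]; last first.
    by rewrite mul0r.
  by rewrite ler_pM2l// perp_lyapunov_depart.
have {}YzU : n%:R * z <= U q.
  rewrite mulr_natl -[n in z *+ n]card_ord -sumr_const; apply: ler_sum => i _.
  by rewrite ler_expR ler_pM2l// q_perp_min.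
have VY : V q <= n%:R * Y.
  rewrite mulr_natl -[n in Y *+ n]card_ord -sumr_const; apply: ler_sum => i _.
  by rewrite ler_expR !mulNr lerN2 ler_pM2l// q_perp_min.
have idle_le : (idle <= n)%N by rewrite -[leqRHS]card_ord max_card.
have s0 : \sum_i theta * q_perp R q i = 0 by rewrite -mulr_sumr sum_q_perp mulr0.
(* The least of numbers with zero sum cannot be positive. *)
have M0 : 0 <= - theta * q_perp R q k0.
  rewrite mulNr oppr_ge0 pmulr_rle0// leNgt; apply/negP => k0_gt0.
  have := sum_q_perp (R := R) q; apply/eqP; rewrite gt_eqF//.
  rewrite (bigD1 k0)//= ltr_pwDl// sumr_ge0// => i _.
  by rewrite (le_trans (ltW k0_gt0))// q_perp_min.
have asym : (U q + V q) / 2 - 3 * n%:R <=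
    U q - n%:R * z + (n%:R * Y - V q).
  have k0_min i : - (- theta * q_perp R q k0) <= theta * q_perp R q i.
    by rewrite mulNr opprK ler_pM2l// q_perp_min.
  have zE' : expR (- (- theta * q_perp R q k0)) = z by rewrite mulNr opprK.
  have VE : \sum_i expR (- (theta * q_perp R q i)) = V q.
    by apply: eq_bigr => i _; rewrite mulNr.
  by have := sum_expR_asymmetry M0 s0 k0_min; rewrite card_ord zE' VE.
have V0 : 0 <= V q by apply: sumr_ge0 => i _; exact: expR_ge0.
have := @drift_arith R n%:R (U q) (V q) Y z e (idle%:R / n%:R) theta
  n_gt0 (expR_ge0 _) (expR_ge0 _) YzU VY V0 e2 e1 _ _ theta0 theta1 asym.
move=> /(_ (divr_ge0 (ler0n _ _) (ler0n _ _))).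
rewrite ler_pdivrMr// mul1r ler_nat => /(_ idle_le) arith.
rewrite big_sumType/=; apply: le_trans (lerD arrivals departures) _.
rewrite -[leRHS]mulrA [perp_lyapunov q]addrC -/(U q) -/(V q).
apply: le_trans (ler_wpM2l (ltW mu0) arith).
(* The two expressions are equal once [idle / n] is substituted for [j]. *)
rewrite le_eqVlt; apply/orP; left; apply/eqP.
by rewrite /Ga /H /cp /cn; field; rewrite gt_eqF.
Qed.

End drift.

(** * Exchangeability *)

(** Reindexing the source states by [sigma] and the moves by [phi] carries the balance equation at
    [sigma y] to the one at [y]. *)
Lemma balanced_sym (R : realType) (T : choiceType) (I : finType)
    (r : I -> T -> R) (tr : I -> T -> T) (sigma : T -> T) (phi : I -> I)
    (p : T -> R) :
  bijective sigma -> bijective phi ->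
  (forall i x, r i (sigma x) = r (phi i) x) ->
  (forall i x, tr i (sigma x) = sigma (tr (phi i) x)) ->
  balanced r tr p -> balanced r tr (p \o sigma).
Proof.
move=> sigma_bij phi_bij r_sym tr_sym pbal y.
have total_sym x : total_rate r (sigma x) = total_rate r x.
  rewrite /total_rate [RHS](reindex phi)/=; last exact: onW_bij.
  by apply: eq_bigr => i _; rewrite r_sym.
rewrite /= -total_sym -pbal /inflow.
rewrite [RHS](reindex_esum [set: T] _ sigma); last by rewrite setTT_bijective.
apply: eq_esum => x _; congr (_ * _)%:E.
rewrite (reindex phi)/=; last exact: onW_bij.
apply: eq_big => [i|i _]; last by rewrite r_sym.
by rewrite tr_sym (inj_eq (bij_inj sigma_bij)).
Qed.

Section jsq_symmetry.
Context {R : realType} {n : nat}.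
Variables (lambda mu : R) (s : {perm 'I_n}).
Implicit Types (q : queues n) (i : 'I_n).

Definition permute q : queues n := [ffun i => q (s i)].

Lemma permute_bij : bijective permute.
Proof.
exists (fun q => [ffun i => q ((s^-1)%g i)]) => q; apply/ffunP => i.
  by rewrite !ffunE permKV.
by rewrite !ffunE permK.
Qed.

Lemma shortest_permute q i :
  (i \in shortest (permute q)) = (s i \in shortest q).
Proof.
rewrite !inE; apply/forallP/forallP => h j.
  by have := h ((s^-1)%g j); rewrite !ffunE permKV.
by rewrite !ffunE.
Qed.

Lemma card_shortest_permute q : #|shortest (permute q)| = #|shortest q|.
Proof.
rewrite -(card_preimset (shortest q) (@perm_inj _ s)).
by apply: eq_card => i; rewrite shortest_permute [RHS]inE.
Qed.

Definition jsq_relabel (k : 'I_n + 'I_n) : 'I_n + 'I_n :=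
  match k with inl i => inl (s i) | inr i => inr (s i) end.

Lemma jsq_relabel_bij : bijective jsq_relabel.
Proof.
exists (fun k => match k with
  | inl i => inl ((s^-1)%g i) | inr i => inr ((s^-1)%g i) end).
  by case=> i /=; rewrite permK.
by case=> i /=; rewrite permKV.
Qed.

Lemma jsq_rate_permute k q :
  jsq_rate lambda mu k (permute q) = jsq_rate lambda mu (jsq_relabel k) q.
Proof.
case: k => i /=.
  by rewrite /arrival_rate shortest_permute card_shortest_permute.
by rewrite /departure_rate ffunE.
Qed.

Lemma jsq_move_permute k q :
  jsq_move k (permute q) = permute (jsq_move (jsq_relabel k) q).
Proof.
by case: k => i; apply/ffunP => j; rewrite !ffunE (inj_eq perm_inj).
Qed.

Lemma q_perp_permute q i : q_perp R (permute q) i = q_perp R q (s i).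
Proof.
rewrite /q_perp ffunE; congr (_ - _ * _).
rewrite [RHS](reindex_inj (@perm_inj _ s))/=.
by apply: eq_bigr => j _; rewrite ffunE.
Qed.

End jsq_symmetry.

(** Serving a busy queue lowers the total number of jobs. This makes the empty state accessible, as
    [balanced_unique] requires. *)
Lemma jsq_descent (R : realType) (n : nat) (lambda mu : R) (q : queues n) :
  0 < mu -> q != [ffun=> 0%N] ->
  exists2 k, 0 < jsq_rate lambda mu k q &
    (\sum_i jsq_move k q i < \sum_i q i)%N.
Proof.
move=> mu0 q0; have [i qi] : exists i, (0 < q i)%N.
  apply/existsP; apply: contraR q0 => /existsPn qi.
  by apply/eqP/ffunP => i; rewrite ffunE; apply/eqP; rewrite eqn0Ngt.
exists (inr i); first by rewrite /= /departure_rate qi.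
rewrite /= (bigD1 i)//= [X in (_ < X)%N](bigD1 i)//= -addSn leq_add//.
  by rewrite ffunE eqxx subn1 prednK.
by apply: leq_sum => j _; rewrite ffunE leq_subr.
Qed.

(** * Stationary expectations and the final bounds *)

Lemma measurable_queues (n : nat) (A : set (queues n)) : measurable A.
Proof. by []. Qed.

Lemma jsq_balanced (R : realType) (n : nat) (lambda mu : R)
    (pi : probability (queues n) R) :
  (0 < n)%N -> 0 <= lambda -> 0 <= mu -> jsq_stationary lambda mu pi ->
  balanced (jsq_rate lambda mu) (@jsq_move n) (fun q => fine (pi [set q])).
Proof.
move=> n0 lambda0 mu0 [P [semigroup rates stat]].
apply: (@stationary_balanced _ (queues n) R _ _ _ (lambda + mu * n%:R)
  choice.pickle P pi) => //.
- exact: jsq_rate_ge0.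
- by move=> q; exact: total_jsq_rate_le.
- move=> x y; have := rates x y.
  by rewrite /jsq_generator jump_rateE exit_rateE.
Qed.

Lemma expectation_esum (R : realType) (n : nat) (pi : probability (queues n) R)
    (f : queues n -> R) : (forall q, 0 <= f q) ->
  ('E_pi[f] = \esum_(q in [set: queues n]) (fine (pi [set q]) * f q)%:E)%E.
Proof.
move=> f0; rewrite unlock.
rewrite (integral_esum _ (@measurable_queues n) (pcan_inj choice.pickleK))//.
apply: eq_esum => q _.
by rewrite -[X in (_ * X)%E]fineK ?fin_num_measure// -EFinM mulrC.
Qed.

Lemma jsq_exchangeable (R : realType) (n : nat) (lambda mu : R)
    (pi : probability (queues n) R) (f : R -> R) (i j : 'I_n) :
  (0 < n)%N -> 0 <= lambda -> 0 < mu -> jsq_stationary lambda mu pi ->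
  (forall x, 0 <= f x) ->
  ('E_pi[fun q => f (q_perp R q i)] = 'E_pi[fun q => f (q_perp R q j)])%E.
Proof.
move=> n0 lambda0 mu0 stat f0; have mu0' := ltW mu0.
have bal := jsq_balanced n0 lambda0 mu0' stat.
set p := fun q => fine (pi [set q]) in bal.
have p0 q : 0 <= p q by exact: fine_ge0.
have p1 : (\esum_(q in [set: queues n]) (p q)%:E = 1)%E.
  rewrite -(expectation_cst pi 1) expectation_esum//.
  by apply: eq_esum => q _; rewrite mulr1.
(* Exchanging queues [i] and [j] is a symmetry of the chain, so uniqueness makes the stationary
   masses invariant under [sigma]. *)
pose sigma := permute (tperm i j).
have sigma_bij : bijective sigma by exact: permute_bij.
have p_sigma1 : (\esum_(q in [set: queues n]) (p (sigma q))%:E = 1)%E.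
  rewrite -p1 [RHS](reindex_esum [set: queues n] _ sigma)//.
  by rewrite setTT_bijective.
have bal_sigma : balanced (jsq_rate lambda mu) (@jsq_move n) (p \o sigma).
  apply: (balanced_sym sigma_bij (jsq_relabel_bij (tperm i j)) _ _ bal).
  - exact: jsq_rate_permute.
  - exact: jsq_move_permute.
have p_sym : p \o sigma =1 p.
  apply: (@balanced_unique R (queues n) _ (jsq_rate lambda mu) (@jsq_move n)
    (lambda + mu * n%:R) _ _ _ _ [ffun=> 0%N] (fun q => \sum_i q i)%N) => //.
  - exact: jsq_rate_ge0.
  - by move=> q; exact: total_jsq_rate_le.
  - by move=> q; exact: p0.
  - by move=> q; exact: jsq_descent.
rewrite !expectation_esum//.
rewrite [RHS](reindex_esum [set: queues n] _ sigma)//; last first.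
  by rewrite setTT_bijective.
apply: eq_esum => q _.
by rewrite q_perp_permute tpermR -/(p q) -/(p (sigma q)) -p_sym.
Qed.

Lemma perp_lyapunov_ge0 (R : realType) (n : nat) (theta : R) (q : queues n) :
  0 <= perp_lyapunov theta q.
Proof. by rewrite addr_ge0// sumr_ge0// => i _; exact: expR_ge0. Qed.

Lemma expectation_perp_lyapunov (R : realType) (n : nat) (mu eps : R)
    (pi : probability (queues n) R) (theta : R) :
  (0 < n)%N -> 0 < mu -> 0 < eps -> eps <= 2^-1 ->
  jsq_stationary (n%:R * mu * (1 - eps)) mu pi ->
  0 < theta -> theta < 96^-1 ->
  ('E_pi[perp_lyapunov theta] <= (16 * n%:R)%:E)%E.
Proof.
move=> n0 mu0 eps0 eps1 stat theta0 theta1.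
have lambda0 : 0 <= n%:R * mu * (1 - eps) by rewrite !mulr_ge0//; lra.
have bal := jsq_balanced n0 lambda0 (ltW mu0) stat.
have p1 : (\esum_(q in [set: queues n]) (fine (pi [set q]))%:E = 1)%E.
  rewrite -(expectation_cst pi 1) expectation_esum//.
  by apply: eq_esum => q _; rewrite mulr1.
rewrite expectation_esum; last exact: perp_lyapunov_ge0.
(* The drift condition holds with [b = 2 n mu theta] and [a = mu theta / 8]. *)
have -> : 16 * n%:R = (mu * theta * (2 * n%:R)) / (mu * theta / 8).
  by field; rewrite !gt_eqF.
apply: (@balanced_lyapunov R (queues n) _ (jsq_rate (n%:R * mu * (1 - eps)) mu)
  (@jsq_move n) (n%:R * mu * (1 - eps) + mu * n%:R)) => // [k q|q|q|q|||q].
- by apply: jsq_rate_ge0 => //; exact: ltW.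
- by apply: total_jsq_rate_le => //; exact: ltW.
- exact: fine_ge0.
- exact: perp_lyapunov_ge0.
- by rewrite divr_gt0// mulr_gt0.
- by rewrite !mulr_ge0// ltW.
- rewrite [leRHS](_ : _ = mu * theta * (2 * n%:R - perp_lyapunov theta q / 8)).
    by apply: perp_lyapunov_drift => //; lra.
  by field.
Qed.

Theorem proposition3 (R : realType) (n : nat) (mu eps : R)
    (pi : probability (queues n) R) (theta : R) :
  (0 < n)%N ->
  0 < mu ->
  0 < eps -> eps <= 2^-1 ->
  jsq_stationary (n%:R * mu * (1 - eps)) mu pi ->
  0 < theta -> theta < 96^-1 ->
  ('E_pi[fun q => (\sum_(i < n) expR (- theta * q_perp R q i)
                   + \sum_(i < n) expR (theta * q_perp R q i))%R]
     <= (128 * n%:R)%:E)%E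
  /\
  forall i : 'I_n,
    ('E_pi[fun q => expR (theta * `|q_perp R q i|)%R] <= 128%:E)%E.
Proof.
move=> n0 mu0 eps0 eps1 stat theta0 theta1.
have n_gt0 : 0 < n%:R :> R by rewrite ltr0n.
have lambda0 : 0 <= n%:R * mu * (1 - eps) by rewrite !mulr_ge0//; lra.
have total := expectation_perp_lyapunov n0 mu0 eps0 eps1 stat theta0 theta1.
split=> [|i].
  by apply: le_trans total _; rewrite lee_fin ler_wpM2r// ler_nat.
(* [f x] dominates [expR (theta * |x|)], and its sum over the queues is [perp_lyapunov]. *)
pose f (x : R) := expR (- theta * x) + expR (theta * x).
have f0 x : 0 <= f x by rewrite addr_ge0// expR_ge0.
apply: (@le_trans _ _ 'E_pi[fun q => f (q_perp R q i)]%E).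
  rewrite !expectation_esum//.
  apply: le_esum => q _; rewrite lee_fin ler_wpM2l ?fine_ge0//.
  rewrite /f; case: ger0P => _; first by rewrite lerDr expR_ge0.
  by rewrite mulrN -mulNr lerDl expR_ge0.
apply: (@le_trans _ _ 16%:E); last by rewrite lee_fin ler_nat.
(* By exchangeability, [n] times the expectation for queue [i] is the sum over all queues, hence at
   most [16 n]. *)
rewrite -(@lee_pmul2l _ n%:R%:E)// -EFinM [n%:R * 16]mulrC.
apply: le_trans total.
have -> : n%:R%:E = (\sum_(j < n) 1%:E)%E :> \bar R.
  by rewrite sumEFin sumr_const card_ord.
rewrite ge0_sume_distrl//.
rewrite (eq_bigr (fun j => 'E_pi[fun q => f (q_perp R q j)])%E); last first.
  by move=> j _; rewrite mul1e; exact: jsq_exchangeable stat f0.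
under eq_bigr do rewrite expectation_esum//.
rewrite -esum_sum; last first.
  by move=> q j _ _; rewrite lee_fin mulr_ge0// fine_ge0.
rewrite expectation_esum; last exact: perp_lyapunov_ge0.
apply: le_esum => q _; rewrite sumEFin lee_fin -mulr_sumr.
by rewrite /f big_split.
Qed.
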